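(* Assume that $X$ is a separable reflexive Banach space and that there exists $C\ge1$ such that $T_N\overset{C}{\hookrightarrow}X$ for all $N\in\mathbb N$. Then either $\mathrm{Sz}(X)>\omega$ or $\mathrm{Sz}(X^* )>\omega$ (inclusive or).
   Context: Banach spaces are real. $\mathbb N$ is the set of positive integers and $\omega$ is the first infinite ordinal. Trees: for $N\in\mathbb N$, $T_N=\bigcup_{i=0}^N\mathbb N^i$ with $\mathbb N^0=\{\emptyset\}$. $|s|$ is the length of $s$; $s\le t$ means that $t$ extends $s$ ($s$ is an ancestor of $t$; $s\le s$). $T_N$ is equipped with the hyperbolic distance $\rho(s,s')=|s|+|s'|-2|u|$, where $u$ is the greatest common ancestor (longest common initial segment) of $s$ and $s'$. Embeddings: for an injective map $f:(M,d)\to(N,\delta)$ between metric spaces, $\mathrm{dist}(f)=\sup_{x\ne y}\frac{\delta(f(x),f(y))}{d(x,y)}\cdot\sup_{x\ne y}\frac{d(x,y)}{\delta(f(x),f(y))}$. We write $M\overset{C}{\hookrightarrow}N$ if there is an injective $f:M\to N$ with $\mathrm{dist}(f)\le C$. Banach spaces carry the norm metric. Szlenk index of a Banach space $Z$: for a weak$^*$-compact $K\subset Z^*$ and $\varepsilon>0$, $s_\varepsilon K=K\setminus\bigcup\{V: V\in\mathcal V\}$, where $\mathcal V$ is the set of relatively weak$^*$-open subsets $V$ of $K$ with norm diameter less than $\varepsilon$. Set $s^0_\varepsilon K=K$, $s_\varepsilon^{\alpha+1}K=s_\varepsilon(s_\varepsilon^\alpha K)$, and $s_\varepsilon^\alpha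 K=\bigcap_{\beta<\alpha}s_\varepsilon^\beta K$ for limit ordinals $\alpha$. $\mathrm{Sz}(Z,\varepsilon)$ is the least ordinal $\alpha$ with $s_\varepsilon^\alpha B_{Z^*}=\emptyset$ ($B_{Z^*}$ the closed unit ball of $Z^*$) if it exists, and $\mathrm{Sz}(Z,\varepsilon)=\infty$ otherwise, where $\infty$ is larger than every ordinal. Finally $\mathrm{Sz}(Z)=\sup_{\varepsilon>0}\mathrm{Sz}(Z,\varepsilon)$. *)

(* Defs.v *)
From HB Require Import structures.
From mathcomp Require Import all_boot all_order all_algebra.
From mathcomp Require Import all_classical all_reals all_analysis.

Set Implicit Arguments.
Unset Strict Implicit.
Unset Printing Implicit Defensive.

Import Order.TTheory GRing.Theory Num.Theory.
Import numFieldNormedType.Exports.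

Local Open Scope classical_set_scope.
Local Open Scope ring_scope.

Section Dual.
Context {R : realType} {Z : normedModType R}.

Definition functional_pred : {pred Z -> R^o} :=
  [pred f | `[< linear f /\ continuous f >]].

Lemma functionalP (f : Z -> R^o) :
  reflect (linear f /\ continuous f) (f \in functional_pred).
Proof. exact: asboolP. Qed.

Lemma functional_submod_closed : submod_closed functional_pred.
Proof.
split.
  apply/functionalP; split; last by move=> x; exact: cvg_cst.
  by move=> a u v; rewrite -[RHS]/(a *: (0 : R^o) + 0) scaler0 addr0.
move=> a f g /functionalP[lf cf] /functionalP[lg cg].
apply/functionalP; split.
  move=> b u v; rewrite -[LHS]/(a *: f _ + g _) -[RHS]/(b *: (a *: f u + g u) + (a *: f v + g v)).
  rewrite lf lg !scalerDr !scalerA (mulrC a b).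
  by rewrite addrACA.
move=> x; apply: cvgD; last exact: cg.
by apply: cvgZr; exact: cf.
Qed.

HB.instance Definition _ :=
  GRing.isSubmodClosed.Build R (Z -> R^o) functional_pred
    functional_submod_closed.

End Dual.

Structure dual (R : realType) (Z : normedModType R) := Dual {
  dual_fun :> Z -> R^o ;
  _ : dual_fun \in functional_pred }.
Arguments dual {R} Z.

Section DualNorm.
Context {R : realType} {Z : normedModType R}.

HB.instance Definition _ := [isSub for @dual_fun R Z].
HB.instance Definition _ := [Choice of dual Z by <:].
HB.instance Definition _ := [SubChoice_isSubLmodule of dual Z by <:].

Lemma dual_linear (f : dual Z) : linear f.
Proof. by case: f => f /=; move=> /functionalP[]. Qed.

Lemma dual_continuous (f : dual Z) : continuous f.
Proof. by case: f => f /=; move=> /functionalP[]. Qed.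

HB.instance Definition _ (f : dual Z) :=
  GRing.isLinear.Build R Z R^o *:%R (dual_fun f) (dual_linear f).

Definition dual_norm (f : dual Z) : R :=
  sup [set `|f x| | x in [set x : Z | `|x| <= 1]].

Lemma dual_norm_has_sup (f : dual Z) :
  has_sup [set `|f x| | x in [set x : Z | `|x| <= 1]].
Proof.
split; first by exists `|f 0|; exists 0 => //=; rewrite normr0.
have /linear_bounded_continuous/bounded_funP/(_ 1)[M fM] := dual_continuous (f := f).
by exists M => _ [x x1 <-]; exact: fM.
Qed.

Lemma dual_norm_ub (f : dual Z) (x : Z) : `|x| <= 1 -> `|f x| <= dual_norm f.
Proof.
move=> x1; apply: sup_upper_bound; first exact: dual_norm_has_sup.
by exists x.
Qed.

Lemma dual_norm_le (f : dual Z) (M : R) :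
  (forall x : Z, `|x| <= 1 -> `|f x| <= M) -> dual_norm f <= M.
Proof.
move=> fM; apply: ge_sup; first by have [] := dual_norm_has_sup f.
by move=> _ [x x1 <-]; exact: fM.
Qed.

Lemma dual_norm_bound (f : dual Z) (x : Z) : `|f x| <= dual_norm f * `|x|.
Proof.
have [->|x0] := eqVneq x 0; first by rewrite linear0 !normr0 mulr0.
have nx : 0 < `|x| by rewrite normr_gt0.
have /(dual_norm_ub f) : `|(`|x|^-1 *: x)| <= 1.
  by rewrite normrZ normfV normr_id mulVf// gt_eqF.
rewrite linearZ/= normrZ normfV normr_id.
by rewrite ler_pdivrMl// mulrC.
Qed.

Lemma dual_ext (f g : dual Z) : (forall x, f x = g x) -> f = g.
Proof. by move=> fg; apply/val_inj/funext. Qed.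

Lemma dual_normD (f g : dual Z) : dual_norm (f + g) <= dual_norm f + dual_norm g.
Proof.
apply: dual_norm_le => x x1; rewrite /= !fctE.
by rewrite (le_trans (ler_normD _ _))// lerD// dual_norm_ub.
Qed.

Lemma dual_normZ (a : R) (f : dual Z) : dual_norm (a *: f) = `|a| * dual_norm f.
Proof.
have dle b g : dual_norm (b *: g) <= `|b| * dual_norm g.
  apply: dual_norm_le => x x1; rewrite /= !fctE normrZ.
  by rewrite ler_wpM2l// dual_norm_ub.
apply/eqP; rewrite eq_le dle/=.
have [->|a0] := eqVneq a 0.
  rewrite normr0 mul0r scale0r (le_trans _ (dual_norm_ub (x := 0) _ _))//.
  by rewrite normr0.
rewrite -ler_pdivlMl ?normr_gt0// -normfV.
by rewrite -{1}(scalerK a0 f) dle.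
Qed.

Lemma dual_norm0_eq0 (f : dual Z) : dual_norm f = 0 -> f = 0.
Proof.
move=> f0; apply: dual_ext => x; have := dual_norm_bound f x.
by rewrite f0 mul0r normr_le0 => /eqP ->.
Qed.

HB.instance Definition _ := Lmodule_isNormed.Build R (dual Z)
  dual_normD dual_normZ dual_norm0_eq0.

End DualNorm.

Definition separable_space {R : realType} (X : normedModType R) : Prop :=
  exists2 D : set X, countable D & dense D.

Section Reflexive.
Context {R : realType} {X : normedModType R}.

Lemma bidual_embedding_subproof (x : X) :
  (fun f : dual X => f x) \in @functional_pred R (dual X).
Proof.
apply/functionalP.
have lx : linear (fun f : dual X => (f x : R^o)) by [].
split=> //.
pose ev : {linear dual X -> R^o} :=
  HB.pack (fun f : dual X => f x) (GRing.isLinear.Build _ _ _ _ _ lx).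
apply: (@bounded_linear_continuous _ _ _ ev); apply/bounded_funP => r.
exists (r * `|x|) => f fr /=.
by rewrite (le_trans (dual_norm_bound f x))// ler_wpM2r.
Qed.

Definition bidual_embedding (x : X) : dual (dual X) :=
  Dual (bidual_embedding_subproof x).

End Reflexive.

Definition reflexive_space {R : realType} (X : normedModType R) : Prop :=
  range (@bidual_embedding R X) = [set: dual (dual X)].

(* Ordinals are represented by well-founded trees: [OSup f] is the least upper
   bound of the family [f] (and [OZero] if the family is empty). Distinct trees
   may denote the same ordinal, namely when [ole] holds in both directions; all
   the notions below only depend on the ordinal. *)
Inductive Ord : Type :=
| OZero
| OSucc of Ord
| OSup (I : Type) of (I -> Ord).

Fixpoint ole (a b : Ord) : Prop :=
  match a with
  | OZero => True
  | OSucc a' =>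
      (fix lt_a' (b : Ord) : Prop :=
         match b with
         | OZero => False
         | OSucc b' => ole a' b'
         | OSup _ g => exists i, lt_a' (g i)
         end) b
  | OSup _ f => forall i, ole (f i) b
  end.

Definition olt (a b : Ord) : Prop := ole (OSucc a) b.

Lemma ole_sup I (g : I -> Ord) i a : ole a (g i) -> ole a (OSup g).
Proof.
elim: a => [//|a IHa|J f IHf] /=; first by exists i.
by move=> fg j; exact/IHf/fg.
Qed.

Lemma ole_refl a : ole a a.
Proof. by elim: a => [//|//|I f IHf] i; apply: (@ole_sup _ _ i); exact: IHf. Qed.

Lemma ole_trans b a c : ole a b -> ole b c -> ole a c.
Proof.
elim: a b c => [//|a IHa|I f IHf]; last by move=> b c fb bc i; exact: IHf (fb i) bc.
elim=> [//|b _|J g IHg] c; last by move=> /= [i agi] gc; exact: IHg agi (gc i).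
move=> /= ab; elim: c => [//|c _|J g IHg] /=; first exact: IHa.
by move=> [i bgi]; exists i; exact: IHg.
Qed.

Lemma ole_succ a : ole a (OSucc a).
Proof.
suff: forall b, ole a b -> ole a (OSucc b) by apply; exact: ole_refl.
elim: a => [//|a IHa|I f IHf] b /=.
  by move=> ab; apply: (@ole_trans (OSucc a) a b _ ab); exact/IHa/ole_refl.
by move=> fb i; exact/IHf/fb.
Qed.

Lemma oltW a b : olt a b -> ole a b.
Proof. by move=> ab; apply: (@ole_trans (OSucc a)) => //; exact: ole_succ. Qed.

Lemma ole_total a b : ole a b \/ olt b a.
Proof.
elim: a b => [|a IHa|I f IHf] b; first by left.
  elim: b => [|b _|J g IHg]; [by right | exact: IHa |].
  have [[i agi]|/forallNP ng] := pselect (exists i, ole (OSucc a) (g i)).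
    by left; exists i.
  by right=> i; have [/ng|] := IHg i.
have [fb|/existsNP[i /= nfb]] := pselect (forall i, ole (f i) b); first by left.
by right; have [//|bf] := IHf i b; exists i.
Qed.

Lemma olt_wf : well_founded olt.
Proof.
suff acc a b : ole b a -> Acc olt b by move=> a; exact: (acc a a (ole_refl a)).
elim: a b => [|a IHa|I f IHf] b ba; constructor => c cb.
- by case: (ole_trans cb ba).
- exact: (IHa c (ole_trans cb ba)).
- by have [i /oltW] := ole_trans cb ba; exact: IHf.
Qed.

Lemma oltnn a : ~ olt a a.
Proof. by elim/(well_founded_ind olt_wf): a => a IHa aa; exact: (IHa a). Qed.

Definition omega : Ord := OSup (fun n : nat => iter n OSucc OZero).

(* Ordinals extended by [None], which stands for $\infty$. *)
Definition eOrd : Type := option Ord.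

Definition eolt (a b : eOrd) : Prop :=
  match a, b with
  | Some a, Some b => olt a b
  | Some _, None => True
  | None, _ => False
  end.

Definition eosup (I : Type) (f : I -> eOrd) : eOrd :=
  if pselect (exists i, f i = None) then None
  else Some (OSup (fun i => odflt OZero (f i))).

Definition is_least (P : set Ord) (a : Ord) : Prop :=
  P a /\ forall b, P b -> ole a b.

Lemma is_least_ex (P : set Ord) : (exists a, P a) -> exists a, is_least P a.
Proof.
move=> [a]; elim/(well_founded_ind olt_wf): a => a IHa Pa.
have [[b [ba Pb]]|/forallNP nb] := pselect (exists b, olt b a /\ P b).
  exact: IHa Pb.
exists a; split=> // b Pb; have [//|ba] := ole_total a b.
by have := nb b => /not_andP[].
Qed.

Definition oleast (P : set Ord) : eOrd :=
  if pselect (exists a, is_least P a) is left ex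
  then Some (projT1 (cid ex)) else None.

(* The intersection with [K] only matters for empty families. When [s] is
   monotone and [s K `<=` K], as for the Szlenk derivation, [oiter] satisfies the
   usual clause at limit ordinals: see [oiter_limit]. *)
Fixpoint oiter (T : Type) (s : set T -> set T) (a : Ord) (K : set T) : set T :=
  match a with
  | OZero => K
  | OSucc a' => s (oiter s a' K)
  | OSup _ f => K `&` \bigcap_i oiter s (f i) K
  end.

Definition is_limit (a : Ord) : Prop :=
  ~ ole a OZero /\ forall b, olt b a -> olt (OSucc b) a.

Section OIter.
Context (T : Type) (s : set T -> set T).
Hypothesis s_mono : forall K L : set T, K `<=` L -> s K `<=` s L.
Hypothesis s_sub : forall K : set T, s K `<=` K.

Lemma oiter_sub a K : oiter s a K `<=` K.
Proof.
elim: a => [//|a IHa|I f _] /=; last exact: subIsetl.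
by move=> x /s_sub/IHa.
Qed.

Lemma oiter_antitone a b K : ole a b -> oiter s b K `<=` oiter s a K.
Proof.
elim: a b => [|a IHa|I f IHf] b; first by move=> _; exact: oiter_sub.
  elim: b => [//|b _ /IHa|J g IHg /= [i /IHg ag]]; first exact: s_mono.
  by apply: subset_trans ag => x [_]; exact.
by move=> fb x bx; split=> [|i _]; [exact: oiter_sub bx | exact: (IHf i b)].
Qed.

Lemma oiter_limit a K : is_limit a ->
  oiter s a K = \bigcap_(b in [set b | olt b a]) oiter s b K.
Proof.
move=> la; apply/seteqP; split=> [x ax b /= /oltW ba|].
  exact: oiter_antitone ba _ ax.
elim: a la => [[/(_ Logic.I)//]|a _ [_ /(_ a (ole_refl _)) /oltnn//]|I f IHf [f0 fl] x xf].
split=> [|i _].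
  by apply: (xf OZero); have [/f0|] := ole_total (OSup f) OZero.
have [ffi|] := ole_total (OSup f) (f i); last exact: xf.
have fif : ole (f i) (OSup f) by apply: (@ole_sup _ _ i); exact: ole_refl.
apply: IHf.
  split=> [fi0|b bfi]; first by apply: f0; exact: ole_trans ffi fi0.
  by apply: ole_trans ffi; apply: fl; exact: ole_trans bfi fif.
by move=> b /= bfi; apply: xf; exact: ole_trans bfi fif.
Qed.

End OIter.

Section Szlenk.
Context {R : realType} {Z : normedModType R}.

Definition weak_star_open (U : set (dual Z)) : Prop :=
  open (U : set (initial_topology (fun f : dual Z => (f : {ptws Z -> R^o})))).

Definition rel_weak_star_open (K V : set (dual Z)) : Prop :=
  exists2 U, weak_star_open U & V = K `&` U.

(* Equal to [-oo], rather than 0, on the empty set. *)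
Definition norm_diam (V : set (dual Z)) : \bar R :=
  ereal_sup [set (`|p.1 - p.2|)%:E | p in V `*` V].

Definition szlenk_deriv (eps : R) (K : set (dual Z)) : set (dual Z) :=
  K `\` \bigcup_(V in [set V | rel_weak_star_open K V /\
                               (norm_diam V < eps%:E)%E]) V.

Lemma szlenk_deriv_sub eps K : szlenk_deriv eps K `<=` K.
Proof. exact: subDsetl. Qed.

Lemma szlenk_deriv_mono eps K L : K `<=` L ->
  szlenk_deriv eps K `<=` szlenk_deriv eps L.
Proof.
move=> KL f [Kf nf]; split; first exact: KL.
move=> [V [[U oU VLU] dV] Vf]; apply: nf; exists (K `&` U); last first.
  by split=> //; move: Vf; rewrite VLU => -[].
split; first by exists U.
apply: le_lt_trans dV; apply: ereal_sup_le => _ [[g h] [/= [Kg Ug] [Kh Uh]] <-].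
by exists (g, h) => //; rewrite VLU; split; split=> //; exact: KL.
Qed.

Lemma szlenk_limit eps a K : is_limit a ->
  oiter (szlenk_deriv eps) a K =
  \bigcap_(b in [set b | olt b a]) oiter (szlenk_deriv eps) b K.
Proof.
by apply: oiter_limit; [exact: szlenk_deriv_mono | exact: szlenk_deriv_sub].
Qed.

Definition dual_unit_ball : set (dual Z) := [set f | `|f| <= 1].

End Szlenk.

Definition Sz_eps {R : realType} (Z : normedModType R) (eps : R) : eOrd :=
  oleast [set a | oiter (@szlenk_deriv R Z eps) a dual_unit_ball = set0].

Definition Sz {R : realType} (Z : normedModType R) : eOrd :=
  eosup (fun eps : {eps : R | 0 < eps} => Sz_eps Z (sval eps)).

Definition posnat : Type := {n : nat | (0 < n)%N}.

Definition tree (N : nat) : Type := N.-bseq posnat.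

Fixpoint common_prefix (T : eqType) (s t : seq T) : seq T :=
  match s, t with
  | x :: s', y :: t' => if x == y then x :: common_prefix s' t' else [::]
  | _, _ => [::]
  end.

Definition tree_dist (R : realType) (N : nat) (s t : tree N) : R :=
  (size s)%:R + (size t)%:R - 2 * (size (common_prefix s t))%:R.

(* When [M] has at least two points, [f] is injective and [d], [d'] are distances,
   both suprema are positive, so that the product is never [0 * +oo]. *)
Definition distortion (R : realType) (M M' : Type) (d : M -> M -> R)
    (d' : M' -> M' -> R) (f : M -> M') : \bar R :=
  (ereal_sup [set (d' (f p.1) (f p.2) / d p.1 p.2)%:E
             | p in [set p | p.1 <> p.2]] *
   ereal_sup [set (d p.1 p.2 / d' (f p.1) (f p.2))%:E
             | p in [set p | p.1 <> p.2]])%E.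

Definition embeds (R : realType) (C : R) (M M' : Type) (d : M -> M -> R)
    (d' : M' -> M' -> R) : Prop :=
  exists2 f : M -> M', injective f & (distortion d d' f <= C%:E)%E.

Definition norm_dist (R : realType) (X : normedModType R) (x y : X) : R :=
  `|x - y|.

(* Main.v *)
Require Import Defs.
From HB Require Import structures.
From mathcomp Require Import all_boot all_order all_algebra.
From mathcomp Require Import all_classical all_reals all_analysis.
From mathcomp Require Import ring lra zify.
Set Implicit Arguments.
Unset Strict Implicit.
Unset Printing Implicit Defensive.
Import Order.TTheory GRing.Theory Num.Theory.
Import numFieldNormedType.Exports.
Local Open Scope classical_set_scope.
Local Open Scope ring_scope.

(** If the conclusion fails, then for every eps > 0 finitely many Szlenk
    derivations exhaust the dual balls of X and of its dual.  This finiteness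
    is turned into convex bodies with asymptotic geometry, and a self-improvement
    argument on trees contradicts the geometry.

    All limits are taken along one free ultrafilter on the integers.  Bounded
    sequences of functionals then have pointwise limits, and in a reflexive
    space bounded sequences have weak limits, without passing to subsequences.

    _Smoothness_ ([smooth_gauge]).  Suppose that N derivations at level
    theta / 2 exhaust the ball, and put tau = 1 / N.  The body of the x such that
    f x + tau j <= 2 for all f surviving j derivations lies between the balls
    of radius 1 and 2.  It is asymptotically smooth: for x in the body and v_n
    weakly null in the unit ball, x + tau v_n is, for almost all n along the
    ultrafilter, in 1 + theta tau times the body.  Indeed, let f_n survive j
    derivations and nearly realise the value of x + tau v_n, and let f be the
    limit of f_n.  If f_n stays far from f, then f survives one more derivation,
    and the gain tau in the constraint on f pays for tau f_n (v_n) <= tau;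
    otherwise f_n (v_n) is within theta / 2 of f (v_n), which tends to 0.

    _Convexity_ ([convex_gauge]).  Applied to the dual of X, the same
    construction yields a body whose polar in X is asymptotically convex: if
    z_n in the polar tends weakly to z and stays at distance at least t from z,
    then z lies in 1 - delta times the polar.

    _Forks_ ([fork_gauge]).  Adding to the convex body a small multiple of a
    much smoother body, the multiple being small against delta and the
    smoothness small against both, gives a body B with both properties.  If p
    and all y_n are in B and the y_n are separated, then some p + y_n is in
    2 kappa B with kappa < 1: the weak limit y of the y_n is in (1 - delta / 2) B
    by convexity, and smoothness at p + s y allows y to be replaced by y_n
    at a smaller cost.

    _Trees_ ([tree_spread_halve]).  In an expanding image of a tree with
    edge vectors in lambda B, each vertex s and child s a form, with the children
    of s a, a fork; so one grandchild s a b can be chosen such that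
    f (s a b) - f s is in 2 kappa lambda B.  The chosen vertices form a tree of
    half the height with all distances doubled; rescaling by 1/2 replaces lambda
    by kappa lambda and keeps the map expanding.  After k steps the edge of a
    tree of height 1 has norm at least 1 and at most 2 kappa^k lambda, which is
    absurd for k large. *)

(** * Limits along a free ultrafilter *)

Lemma free_ultrafilter_exists :
  exists F : set_system nat, UltraFilter F /\ \oo `<=` F.
Proof. exact: ultraFilterLemma. Qed.

Definition freeU : set_system nat := projT1 (cid free_ultrafilter_exists).

#[local] Instance freeU_ultra : UltraFilter freeU.
Proof. by have [] := projT2 (cid free_ultrafilter_exists). Qed.

Lemma near_freeU (P : nat -> Prop) : \oo [set n | P n] -> \forall n \near freeU, P n.
Proof. by have [_] := projT2 (cid free_ultrafilter_exists); exact. Qed.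

Lemma freeU_dichotomy (P : nat -> Prop) :
  (\forall n \near freeU, P n) \/ (\forall n \near freeU, ~ P n).
Proof. exact: (in_ultra_setVsetC [set n | P n]). Qed.

Lemma bounded_cvg_freeU (R : realType) (u : nat -> R) (M : R) :
  (forall n, `|u n| <= M) -> exists l : R, u n @[n --> freeU] --> l.
Proof.
move=> uM; have uI : \forall n \near freeU, `[- M, M]%classic (u n).
  by apply: filterE => n; rewrite /= in_itv /= -ler_norml.
have [l [_ cl]] := @segment_compact R (- M) M (u @ freeU) _ uI.
exists l => A lA; have [//|nA] := freeU_dichotomy (fun n => A (u n)).
by have [x [nAx /nAx]] := cl (~` A) A nA lA.
Qed.

Lemma freeU_lim_le (R : realType) (u : nat -> R) (l b : R) :
  u n @[n --> freeU] --> l -> (\forall n \near freeU, u n <= b) -> l <= b.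
Proof.
move=> ul ub; rewrite leNgt; apply/negP => bl.
have [n []] := filter_ex (filterI ub (cvgr_gt l ul b bl)) => /=.
by rewrite leNgt => /negP.
Qed.

Section Functionals.
Context {R : realType} {Z : normedModType R}.

Lemma dual_linearE (f : dual Z) (a : R) (u v : Z) :
  f (a *: u + v) = a * f u + f v :> R.
Proof. exact: dual_linear. Qed.

Lemma dual_appD (f : dual Z) (u v : Z) : f (u + v) = f u + f v :> R.
Proof. exact: raddfD. Qed.

Lemma dual_appB (f : dual Z) (u v : Z) : f (u - v) = f u - f v :> R.
Proof. exact: raddfB. Qed.

Lemma dual_appZ (f : dual Z) (a : R) (u : Z) : f (a *: u) = a * f u :> R.
Proof. exact: linearZ. Qed.

Lemma dualD_app (f g : dual Z) (u : Z) : (f + g) u = f u + g u :> R.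
Proof. by []. Qed.

Lemma dualB_app (f g : dual Z) (u : Z) : (f - g) u = f u - g u :> R.
Proof. by []. Qed.

Lemma dualZ_app (a : R) (f : dual Z) (u : Z) : (a *: f) u = a * f u :> R.
Proof. by []. Qed.

Lemma dual_of_bounded (g : Z -> R) (M : R) : 0 <= M ->
    (forall (a : R) u v, g (a *: u + v) = a * g u + g v) ->
    (forall x, `|g x| <= M * `|x|) ->
  exists2 f : dual Z, forall x, f x = g x & `|f| <= M.
Proof.
move=> M0 lg bg.
have lg' : linear (g : Z -> R^o) by [].
pose h : {linear Z -> R^o} :=
  HB.pack (g : Z -> R^o) (GRing.isLinear.Build _ _ _ _ _ lg').
have fP : (g : Z -> R^o) \in @functional_pred R Z.
  apply/functionalP; split=> //.
  apply: (@bounded_linear_continuous _ _ _ h); apply/bounded_funP => r.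
  exists (M * r) => x xr /=; apply: (le_trans (bg x)).
  by rewrite ler_wpM2l.
exists (Dual fP) => //; apply: dual_norm_le => x x1 /=.
by rewrite (le_trans (bg x))// ler_piMr.
Qed.

Lemma dual_ball_le (f : dual Z) (M : R) (x : Z) :
  `|f| <= M -> `|f x| <= M * `|x|.
Proof.
by move=> fM; rewrite (le_trans (dual_norm_bound f x))// ler_wpM2r.
Qed.

Definition wstar_cvg (f_ : nat -> dual Z) (f : dual Z) :=
  forall x, (f_ n x : R) @[n --> freeU] --> (f x : R).

Definition weak_cvg (z_ : nat -> Z) (z : Z) :=
  forall f : dual Z, (f (z_ n) : R) @[n --> freeU] --> (f z : R).

(** Alaoglu's theorem along the ultrafilter: the pointwise limits of bounded
    scalar sequences assemble into a functional. *)
Lemma dual_ball_wstar_compact (f_ : nat -> dual Z) (M : R) :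
  (forall n, `|f_ n| <= M) -> exists2 f, wstar_cvg f_ f & `|f| <= M.
Proof.
move=> fM; have M0 : 0 <= M by apply: le_trans (fM 0%N).
have /choice[g gP] x : exists l : R, (f_ n x : R) @[n --> freeU] --> l.
  by apply: (@bounded_cvg_freeU _ _ (M * `|x|)) => n; exact: dual_ball_le.
have [|x|f fg fM'] := @dual_of_bounded g M M0.
- move=> a u v; apply: (cvg_unique _ (gP (a *: u + v))) => //.
  have -> : (fun n => f_ n (a *: u + v) : R) = (fun n => a * f_ n u + f_ n v).
    by apply/funext => n; exact: dual_linearE.
  by apply: cvgD; [apply: cvgMr|]; exact: gP.
- apply: freeU_lim_le (cvg_norm (gP x)) _.
  by apply: filterE => n; exact: dual_ball_le.
- by exists f => // x; rewrite fg; exact: gP.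
Qed.

Lemma wstar_open_near (f_ : nat -> dual Z) (f : dual Z) (O : set (dual Z)) :
  weak_star_open O -> wstar_cvg f_ f -> O f -> \forall n \near freeU, O (f_ n).
Proof.
move=> [A oA AO] ff Of.
have FA : ((fun n => f_ n : {ptws Z -> R^o}) @ freeU) A.
  have /(@pointwise_cvgP Z R^o) : forall x : Z,
      (fun g : {ptws Z -> R^o} => g x) @ ((fun n => f_ n : {ptws Z -> R^o}) @ freeU) --> (f x : R^o).
    by move=> x; exact: ff.
  apply; apply: open_nbhs_nbhs; split=> //.
  by rewrite -AO in Of.
by rewrite -AO.
Qed.

End Functionals.

(** * The Hahn-Banach theorem for the norm *)

Section HahnBanach.
Context {R : realType} {Z : normedModType R}.
Implicit Types (p : Z -> R) (x y : Z).

Definition sublinear p :=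
  (forall x y, p (x + y) <= p x + p y) /\
  (forall a x, 0 < a -> p (a *: x) <= a * p x).

Lemma sublinear0 p : sublinear p -> p 0 = 0.
Proof.
move=> [_ pZ]; have := pZ 2 0; have := pZ 2^-1 0.
by rewrite !scaler0 => h1 h2; have := h1 _; have := h2 _; lra.
Qed.

Lemma sublinearZ p a x : sublinear p -> 0 <= a -> p (a *: x) = a * p x.
Proof.
move=> sp; rewrite le_eqVlt => /predU1P[<-|a0].
  by rewrite scale0r mul0r sublinear0.
apply/eqP; rewrite eq_le; apply/andP; split; first exact: sp.2.
by rewrite -ler_pdivlMl// -{1}[x](scalerK (lt0r_neq0 a0))
  sp.2// invr_gt0.
Qed.

Lemma sublinear_opp p x : sublinear p -> - p (- x) <= p x.
Proof. by move=> sp; have := sp.1 x (- x); rewrite subrr sublinear0//; lra. Qed.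

(** The largest sublinear minorant of p with slope p y in the direction y: if p
    is minimal then p is its own shift, which forces additivity.  Shifting the
    norm along x yields a value at - x equal to minus the norm of x, so every
    smaller linear functional norms x. *)
Definition shift p y x : R :=
  inf [set p (x + t *: y) - t * p y | t in [set t | 0 <= t]].

Lemma shift_le p y x t : sublinear p -> 0 <= t ->
  shift p y x <= p (x + t *: y) - t * p y.
Proof.
move=> sp t0; apply: ge_inf; last by exists t.
exists (- p (- x)) => _ [s s0 <-].
have := sp.1 (x + s *: y) (- x); rewrite addrAC subrr add0r sublinearZ//.
by lra.
Qed.

Arguments shift_le {p} y x {t}.

Lemma le_shift p y x b :
  (forall t, 0 <= t -> b <= p (x + t *: y) - t * p y) -> b <= shift p y x.
Proof.
move=> h; apply: lb_le_inf; first by exists (p (x + 0 *: y) - 0 * p y), 0 => /=.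
by move=> _ [t t0 <-]; exact: h.
Qed.

Lemma shift_sublinear p y : sublinear p -> sublinear (shift p y).
Proof.
move=> sp; split=> [u v|a x a0].
  rewrite -lerBlDr; apply: le_shift => s s0; rewrite lerBlDr -lerBlDl.
  apply: le_shift => t t0; rewrite lerBlDl.
  apply: (le_trans (shift_le y _ sp (addr_ge0 s0 t0))).
  have := sp.1 (u + s *: y) (v + t *: y).
  by rewrite addrACA -scalerDl mulrDl; lra.
rewrite -ler_pdivrMl//; apply: le_shift => t t0; rewrite ler_pdivrMl//.
apply: (le_trans (shift_le y _ sp (mulr_ge0 (ltW a0) t0))).
have := sublinearZ (x + t *: y) sp (ltW a0).
by rewrite scalerDr scalerA => ->; rewrite mulrBr mulrA.
Qed.

Lemma shift_dom p y x : sublinear p -> shift p y x <= p x.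
Proof.
by move=> sp; apply: le_trans (shift_le y x sp (lexx 0)) _ => //;
  rewrite scale0r addr0 mul0r subr0.
Qed.

Arguments shift_dom {p} y x.

Lemma minimal_sublinear_linear p : sublinear p ->
    (forall q, sublinear q -> (forall x, q x <= p x) -> forall x, p x <= q x) ->
  forall a x y, p (a *: x + y) = a * p x + p y.
Proof.
move=> sp pmin.
have pD x y : p (x + y) = p x + p y.
  apply/eqP; rewrite eq_le sp.1/=.
  have := pmin _ (shift_sublinear y sp) (fun x => shift_dom y x sp) x.
  move=> /le_trans/(_ (shift_le y x sp ler01)).
  by rewrite scale1r mul1r lerBrDr.
have pN x : p (- x) = - p x.
  by apply/eqP; rewrite -subr_eq0 opprK -pD addNr sublinear0.
move=> a x y; rewrite pD; congr (_ + _).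
have [a0|a0] := leP 0 a; first exact: sublinearZ.
by rewrite -[a]opprK scaleNr pN sublinearZ ?mulNr// oppr_ge0 ltW.
Qed.

(** Zorn's lemma applies because the infimum of a chain of sublinear functionals
    is sublinear; it is finite since q x >= - q (- x) >= - p (- x). *)
Lemma minimal_sublinear_exists p : sublinear p ->
  exists q, [/\ sublinear q, forall x, q x <= p x &
    forall r, sublinear r -> (forall x, r x <= q x) -> forall x, q x <= r x].
Proof.
move=> sp; pose T := {q : Z -> R | sublinear q /\ forall x, q x <= p x}.
pose below (q r : T) := `[< forall x, sval r x <= sval q x >].
pose p0 : T := exist _ p (conj sp (fun x => lexx (p x))).
have [| |A Atot|[q [sq qp]] qmin] := ZL_preorder p0 (R := below).
- by move=> q; exact/asboolP.
- by move=> q r s /asboolP qr /asboolP rs; apply/asboolP => x; apply: le_trans (qr x).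
- have [[q0 Aq0]|A0] := pselect (exists q, A q); last first.
    by exists p0 => q Aq; case: A0; exists q.
  pose m x := inf [set sval q x | q in A].
  have mle q x : A q -> m x <= sval q x.
    move=> Aq; apply: ge_inf; last by exists q.
    exists (- p (- x)) => _ [[r [sr rp]] _ <-] /=.
    by apply: le_trans (sublinear_opp x sr); rewrite lerN2.
  have lem x b : (forall q, A q -> b <= sval q x) -> b <= m x.
    move=> h; apply: lb_le_inf; first by exists (sval q0 x), q0.
    by move=> _ [q Aq <-]; exact: h.
  have sm : sublinear m.
    split=> [x y|a x a0].
      rewrite -lerBlDr; apply: (lem _ _) => q Aq; rewrite lerBlDr -lerBlDl.
      apply: (lem _ _) => r Ar; rewrite lerBlDl.
      have [/asboolP qr|/asboolP rq] := Atot q r Aq Ar.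
        apply: le_trans (mle r _ Ar) _; apply: le_trans ((svalP r).1.1 _ _) _.
        by rewrite lerD2r; exact: qr.
      apply: le_trans (mle q _ Aq) _; apply: le_trans ((svalP q).1.1 _ _) _.
      by rewrite lerD2l; exact: rq.
    rewrite -ler_pdivrMl//; apply: (lem _ _) => q Aq; rewrite ler_pdivrMl//.
    by apply: le_trans (mle q _ Aq) _; exact: (svalP q).1.2.
  have mp x : m x <= p x.
    by apply: le_trans (mle q0 _ Aq0) _; exact: (svalP q0).2.
  by exists (exist _ m (conj sm mp)) => q Aq; apply/asboolP => x; exact: mle.
exists q; split=> // r sr rq.
have rp x : r x <= p x by exact: le_trans (rq x) (qp x).
by have /asboolP := qmin (exist _ r (conj sr rp)) (introT (asboolP _) rq).
Qed.

(** A minimal sublinear functional below the shift of the norm along x. *)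
Lemma norming_functional (x : Z) : exists2 f : dual Z, `|f| <= 1 & f x = `|x| :> R.
Proof.
have snorm : sublinear (fun y => `|y|).
  split=> [u v|a u a0]; first exact: ler_normD.
  by rewrite normrZ gtr0_norm.
have [f [sf fle fmin]] := minimal_sublinear_exists (shift_sublinear x snorm).
have fnorm y : f y <= `|y| by exact: le_trans (fle y) (shift_dom x y snorm).
have flin := minimal_sublinear_linear sf fmin.
have fN y : f (- y) = - f y.
  by have := flin (-1) y 0; rewrite scaleN1r addr0 sublinear0// addr0 mulN1r.
have [y|g gf g1] := dual_of_bounded ler01 flin.
  by rewrite mul1r ler_norml fnorm andbT -[f y]opprK lerN2 -fN -[`|y|]normrN fnorm.
exists g => //; apply/eqP; rewrite gf eq_le fnorm /=.
have := le_trans (fle (- x)) (shift_le x (- x) snorm ler01).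
by rewrite fN scale1r addNr normr0 mul1r sub0r lerN2.
Qed.

Lemma norm_le_of_functionals (x : Z) (M : R) :
  (forall f : dual Z, `|f| <= 1 -> f x <= M) -> `|x| <= M.
Proof. by move=> h; have [f f1 <-] := norming_functional x; exact: h. Qed.

End HahnBanach.

(** * Szlenk derivations and limits *)

Section SzlenkDerivation.
Context {R : realType} {Z : normedModType R}.
Implicit Types (K : set (dual Z)) (f : dual Z) (eps : R).

(** Closedness under limits along the one fixed ultrafilter, which passes to
    Szlenk derivatives. *)
Definition wstar_closed K := forall (f_ : nat -> dual Z) f,
  (\forall n \near freeU, K (f_ n)) -> wstar_cvg f_ f -> K f.

Lemma wstar_closed_ball : wstar_closed (@dual_unit_ball R Z).
Proof.
move=> f_ f f1 ff; apply: dual_norm_le => x x1.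
apply: freeU_lim_le (cvg_norm (ff x)) _; apply: filterS f1 => n fn1.
by rewrite (le_trans (dual_ball_le _ fn1))// mul1r.
Qed.

Lemma szlenk_deriv_wstar_closed eps K :
  wstar_closed K -> wstar_closed (szlenk_deriv eps K).
Proof.
move=> cK f_ f sf ff.
have Kf_ : \forall n \near freeU, K (f_ n) by apply: filterS sf => n [].
split; first exact: cK ff.
move=> [V [ [G oG VE] dV] ]; rewrite VE => -[_ Gf].
have [n [ [_ nV] [Kn Gn] ] ] :=
  filter_ex (filterI sf (filterI Kf_ (wstar_open_near oG ff Gf))).
by apply: nV; exists V; [split=> //; exists G | rewrite VE].
Qed.

(** A relatively open piece of K that contains f contains some f_n, so its
    diameter is at least the distance from f_n to f. *)
Lemma szlenk_deriv_jump eps K (f_ : nat -> dual Z) f : wstar_closed K ->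
    (\forall n \near freeU, K (f_ n)) -> wstar_cvg f_ f ->
    (\forall n \near freeU, eps <= `|f_ n - f|) ->
  szlenk_deriv eps K f.
Proof.
move=> cK Kf_ ff jump; have Kf : K f by exact: cK ff.
split=> // -[V [ [G oG VE] dV]]; rewrite VE => -[_ Gf].
have [n [jn [Kn Gn]]] :=
  filter_ex (filterI jump (filterI Kf_ (wstar_open_near oG ff Gf))).
suff : (`|f_ n - f|%:E < eps%:E)%E by rewrite lte_fin ltNge jn.
apply: le_lt_trans dV; apply: ereal_sup_ubound; exists (f_ n, f) => //.
by rewrite VE.
Qed.

Lemma iter_szlenk_deriv_closed eps n :
  wstar_closed (iter n (szlenk_deriv eps) (@dual_unit_ball R Z)).
Proof.
elim: n => [|n IHn]; first exact: wstar_closed_ball.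
exact: szlenk_deriv_wstar_closed.
Qed.

Lemma iter_szlenk_deriv_sub eps n :
  iter n (szlenk_deriv eps) (@dual_unit_ball R Z) `<=` dual_unit_ball.
Proof. by elim: n => [//|n IHn] f /szlenk_deriv_sub/IHn. Qed.

Lemma iter_szlenk_deriv_anti eps m n : (m <= n)%N ->
  iter n (szlenk_deriv eps) (@dual_unit_ball R Z) `<=`
  iter m (szlenk_deriv eps) (@dual_unit_ball R Z).
Proof.
move=> /subnK <-; elim: (n - m)%N => [//|k IHk] f.
by rewrite addSn => /szlenk_deriv_sub/IHk.
Qed.

Lemma oiter_nat T (s : set T -> set T) n (A : set T) :
  oiter s (iter n OSucc OZero) A = iter n s A.
Proof. by elim: n => //= n ->. Qed.

(** By compactness the index at level eps, being at most omega, is finite: a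
    limit of functionals f_n surviving n derivations survives all of them, hence
    lies in the omega-th derived set. *)
Lemma finite_szlenk_index : ~ eolt (Some omega) (Sz Z) -> forall eps, 0 < eps ->
  exists n, iter n (szlenk_deriv eps) (@dual_unit_ball R Z) = set0.
Proof.
rewrite /Sz /eosup; case: pselect => [_ []//|nN] /= nlt eps eps0.
have Sz_le : ole (odflt OZero (Sz_eps Z eps)) omega.
  have [|//] := ole_total (OSup (fun e : {e : R | 0 < e} =>
    odflt OZero (Sz_eps Z (sval e)))) omega.
  by move=> /(_ (exist _ eps eps0)).
have : Sz_eps Z eps <> None.
  by move=> SzN; apply: nN; exists (exist _ eps eps0).
move: Sz_le; rewrite /Sz_eps /oleast; case: pselect => // ex /= Sz_le _.
have [/= s0 _] := projT2 (cid ex).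
apply: contrapT => /forallNP ne.
have /choice[f_ fP] n : exists f,
    iter n (szlenk_deriv eps) (@dual_unit_ball R Z) f.
  by have /eqP/set0P := ne n.
have [f ff _] := dual_ball_wstar_compact
  (fun n => iter_szlenk_deriv_sub (fP n)).
have : oiter (szlenk_deriv eps) omega (@dual_unit_ball R Z) f.
  split.
    apply: (@wstar_closed_ball f_) => //; apply: filterE => n.
    exact: iter_szlenk_deriv_sub (fP n).
  move=> m _; rewrite oiter_nat; apply: iter_szlenk_deriv_closed ff.
  apply: near_freeU; exists m => // n /= mn; exact: iter_szlenk_deriv_anti (fP n).
move=> /(oiter_antitone (@szlenk_deriv_mono _ _ eps)
  (@szlenk_deriv_sub _ _ eps) Sz_le).
by rewrite s0.
Qed.

End SzlenkDerivation.

(** * Gauges of convex bodies *)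

Section Gauges.
Context {R : realType} {Z : normedModType R}.
Implicit Types G : R -> Z -> Prop.

(** G a x stands for the membership of x in a B, where B is a convex body.
    Working with this relation keeps sums and multiples of bodies linear in the
    scaling factor and avoids infima. *)
Record gauge G : Prop := Gauge {
  gaugeD : forall a b x y, G a x -> G b y -> G (a + b) (x + y);
  gaugeZ : forall c a x, 0 <= c -> G a x -> G (c * a) (c *: x);
  gauge_ball : exists2 c, 0 < c & forall x, `|x| <= 1 -> G c x }.

Lemma gauge_norm G c x : gauge G -> (forall y, `|y| <= 1 -> G c y) ->
  G (`|x| * c) x.
Proof.
move=> gG ball; have [x0|x0] := eqVneq `|x| 0.
  rewrite x0 (normr0_eq0 x0).
  have /(gaugeZ gG (lexx 0)) : G c 0 by apply: ball; rewrite normr0.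
  by rewrite scaler0.
have -> : G (`|x| * c) x = G (`|x| * c) (`|x| *: (`|x|^-1 *: x)).
  by rewrite scalerA divff// scale1r.
apply: (gaugeZ gG) => //; apply: ball.
by rewrite normrZ normfV normr_id mulVf.
Qed.

Lemma gauge_le G a b x : gauge G -> a <= b -> G a x -> G b x.
Proof.
move=> gG ab Gx; have [c c0 ball] := gauge_ball gG.
have /(gaugeD gG Gx) : G ((b - a) / c * c) (((b - a) / c) *: 0).
  apply: (gaugeZ gG); first by rewrite divr_ge0 ?subr_ge0// ltW.
  by apply: ball; rewrite normr0.
by rewrite scaler0 addr0 divfK ?lt0r_neq0// addrC subrK.
Qed.

End Gauges.

(** * Asymptotically smooth bodies *)

Section AsymptoticSmoothness.
Context {R : realType} {Z : normedModType R}.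

(** A bound at the single scale tau; theta tau is small compared to the size
    tau of the perturbation when theta is small. *)
Definition asymptotically_smooth (G : R -> Z -> Prop) (tau theta : R) :=
  forall (x : Z) (v_ : nat -> Z), G 1 x -> (forall n, `|v_ n| <= 1) ->
  weak_cvg v_ 0 ->
  \forall n \near freeU, G (1 + theta * tau) (x + tau *: v_ n).

(** The body is cut out by the constraints f x + tau j <= 2 for f surviving j
    derivations, where tau = 1 / N and no functional survives N derivations, so
    that the weights tau j stay below 1.  That the bounds 1 and 2 on the radii do
    not depend on theta is essential for combining this body with a convex one. *)
Lemma smooth_gauge (theta : R) : 0 < theta ->
    (forall eps : R, 0 < eps ->
      exists n, iter n (szlenk_deriv eps) (@dual_unit_ball R Z) = set0) ->
  exists G, exists2 tau, 0 < tau <= 1 &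
    [/\ gauge G, forall x, `|x| <= 1 -> G 1 x,
        forall x, G 1 x -> `|x| <= 2 &
        asymptotically_smooth G tau theta].
Proof.
move=> theta0 /(_ (theta / 2))[|N sN]; first by rewrite divr_gt0.
pose s n := iter n (szlenk_deriv (theta / 2)) (@dual_unit_ball R Z).
have N0 : (0 < N)%N.
  case: N sN => // /seteqP[/(_ 0) s0 _]; exfalso; apply: s0.
  by rewrite /dual_unit_ball /= normr0.
have s_lt j f : s j f -> (j < N)%N.
  move=> sf; rewrite ltnNge; apply/negP => Nj.
  by have := iter_szlenk_deriv_anti Nj sf; rewrite sN.
pose tau : R := N%:R^-1.
have tau0 : 0 < tau by rewrite invr_gt0 ltr0n.
have tauN j f : s j f -> tau * j%:R <= 1.
  by move=> /s_lt/ltnW jN; rewrite mulrC ler_pdivrMr ?ltr0n// mul1r ler_nat.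
pose G (a : R) (x : Z) := forall j f, s j f -> f x <= a * (2 - tau * j%:R).
have G1 x : `|x| <= 1 -> G 1 x.
  move=> x1 j f sf; rewrite mul1r.
  have fx : f x <= 1.
    apply: le_trans (ler_norm _) _; rewrite -[1](mulr1 1).
    apply: le_trans (dual_ball_le x (iter_szlenk_deriv_sub sf)) _.
    by rewrite ler_pM2l.
  by have := tauN _ _ sf; lra.
exists G, tau.
  by rewrite tau0 invf_le1 ?ltr0n// ler1n.
split=> // [|x Gx|x v_ Gx v1 v0].
- split; last by exists 1.
  + by move=> a b x y Gx Gy j f sf; rewrite dual_appD mulrDl lerD ?Gx ?Gy.
  + by move=> c a x c0 Gx j f sf; rewrite dual_appZ -mulrA ler_wpM2l ?Gx.
- apply: norm_le_of_functionals => f f1.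
  by have := Gx 0%N f f1; rewrite mulr0 subr0 mul1r.
(* The values of j are finitely many, so they can be treated one at a time. *)
have level j : \forall n \near freeU, forall f, s j f ->
    f (x + tau *: v_ n) <= 2 - tau * j%:R + theta * tau.
  have [//|bad] := freeU_dichotomy (fun n => forall f, s j f ->
    f (x + tau *: v_ n) <= 2 - tau * j%:R + theta * tau).
  have /choice[f_ fP] n : exists f : dual Z, `|f| <= 1 /\
      ((~ forall f, s j f -> f (x + tau *: v_ n) <= 2 - tau * j%:R + theta * tau)
       -> s j f /\ 2 - tau * j%:R + theta * tau < f (x + tau *: v_ n)).
    have [ok|/existsNP[f /not_implyP[sf /negP]]] := pselect (forall f, s j f ->
        f (x + tau *: v_ n) <= 2 - tau * j%:R + theta * tau).
      by exists 0; rewrite normr0.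
    by rewrite -ltNge => fx; exists f; split; first exact: iter_szlenk_deriv_sub sf.
  have [f ff _] := dual_ball_wstar_compact (fun n => (fP n).1).
  have sf_ : \forall n \near freeU, s j (f_ n).
    by apply: filterS bad => n /(fP n).2[].
  have big : \forall n \near freeU,
      2 - tau * j%:R + theta * tau < f_ n x + tau * f_ n (v_ n).
    by apply: filterS bad => n /(fP n).2[_]; rewrite dual_appD dual_appZ.
  have closed_s : wstar_closed (s j) by exact: iter_szlenk_deriv_closed.
  have fx_lt : \forall n \near freeU, f_ n x < f x + theta / 4 * tau.
    by apply: cvgr_lt (ff x) _ _; rewrite ltrDl mulr_gt0// divr_gt0.
  have fv_lt : \forall n \near freeU, f (v_ n) < theta / 4.
    by apply: cvgr_lt (v0 f) _ _; rewrite linear0 divr_gt0.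
  (* If the f_n stay far from f, then f meets the constraint of index j.+1, which
     is stronger by tau; otherwise f_n (v_n) is almost f (v_n), which is small. *)
  have [jump|small] := freeU_dichotomy (fun n => theta / 2 <= `|f_ n - f|).
    have /Gx : s j.+1 f by exact: szlenk_deriv_jump closed_s sf_ ff jump.
    have [n [bn xn]] := filter_ex (filterI big fx_lt).
    have fn1 : f_ n (v_ n) <= 1.
      apply: le_trans (ler_norm _) _; apply: le_trans (dual_ball_le _ (fP n).1) _.
      by rewrite mul1r.
    have := ler_wpM2l (ltW tau0) fn1; have := mulr_gt0 theta0 tau0.
    by rewrite mul1r -natr1 => ? ? ?; lra.
  have /Gx fx : s j f by exact: closed_s ff.
  have [n [bn [xn [vn /negP]]]] :=
    filter_ex (filterI big (filterI fx_lt (filterI fv_lt small))).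
  rewrite -ltNge => sn.
  have : f_ n (v_ n) - f (v_ n) <= theta / 2.
    rewrite -dualB_app; apply: le_trans (ler_norm _) _.
    apply: le_trans (dual_ball_le _ (ltW sn)) _.
    by rewrite ler_piMr// ltW// divr_gt0.
  move=> /(ler_wpM2l (ltW tau0)); have := ltW vn => /(ler_wpM2l (ltW tau0)).
  by rewrite mul1r in fx; move=> ? ?; exfalso; lra.
have : \forall n \near freeU, forall j : 'I_N, forall f, s j f ->
    f (x + tau *: v_ n) <= 2 - tau * j%:R + theta * tau.
  by apply: filter_forall => j; exact: level.
apply: filterS => n ub j f sf; apply: le_trans (ub (Ordinal (s_lt _ _ sf)) _ sf) _.
have := ler_wpM2l (ltW (mulr_gt0 theta0 tau0)) (tauN _ _ sf).
by rewrite /=; lra.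
Qed.

End AsymptoticSmoothness.

(** * Asymptotically convex bodies *)

Section AsymptoticConvexity.
Context {R : realType} {X : normedModType R}.
Context (reflX : reflexive_space X).

Lemma weak_cvg_norm_le (z_ : nat -> X) (z : X) (M : R) :
  weak_cvg z_ z -> (forall n, `|z_ n| <= M) -> `|z| <= M.
Proof.
move=> zz zM; apply: norm_le_of_functionals => f f1.
apply: freeU_lim_le (zz f) _; apply: filterE => n.
apply: le_trans (ler_norm _) _; apply: le_trans (dual_ball_le _ f1) _.
by rewrite mul1r.
Qed.

(** The limit of the z_n in the bidual is evaluation at a point of X. *)
Lemma reflexive_weak_compact (z_ : nat -> X) (M : R) :
  (forall n, `|z_ n| <= M) -> exists z, weak_cvg z_ z.
Proof.
move=> zM; have JM n : `|bidual_embedding (z_ n)| <= M.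
  apply: dual_norm_le => f f1 /=.
  by apply: le_trans (dual_ball_le _ f1) _; rewrite mul1r.
have [F JF _] := dual_ball_wstar_compact JM.
have [z _ zF] : range (@bidual_embedding R X) F by rewrite reflX.
by exists z => f; have := JF f; rewrite -zF.
Qed.

Lemma reflexive_weak_cvg_dual (w_ : nat -> dual X) (w : dual X) :
  wstar_cvg w_ w -> weak_cvg w_ w.
Proof.
move=> ww F; have [x _ <-] : range (@bidual_embedding R X) F by rewrite reflX.
exact: ww.
Qed.

Definition polar (G : R -> dual X -> Prop) (a : R) (x : X) :=
  forall g, G 1 g -> g x <= a.

(** Weak limits with jumps of size at least t shrink the gauge by delta. *)
Definition asymptotically_convex (G : R -> X -> Prop) (t delta : R) :=
  forall (z_ : nat -> X) (z : X), (forall n, G 1 (z_ n)) -> weak_cvg z_ z ->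
  (\forall n \near freeU, t <= `|z_ n - z|) -> G (1 - delta) z.

Lemma polar_scale (G : R -> dual X -> Prop) (a : R) (g : dual X) (x : X) :
  gauge G -> 0 < a -> G a g -> polar G 1 x -> g x <= a.
Proof.
move=> gG a0 Gg Gx; have a0' : a != 0 by rewrite gt_eqF.
have /(gaugeZ gG)/(_ Gg) : 0 <= a^-1 by rewrite invr_ge0 ltW.
by rewrite mulVf// => /Gx; rewrite dualZ_app ler_pdivrMl// mulr1.
Qed.

(** Duality between smoothness and convexity.  Let h_n norm z_n - z and tend
    weak-star to h.  For g in the smooth body of the dual, g + tau (h_n - h) / 2
    is almost in it, and its value at z_n is at most 1 + small; but that value is
    nearly bounded below by g z + tau t / 2, since (h_n - h) z tends to 0. *)
Lemma convex_gauge (t : R) : 0 < t <= 1 ->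
    (forall eps : R, 0 < eps -> exists n,
      iter n (szlenk_deriv eps) (@dual_unit_ball R (dual X)) = set0) ->
  exists G, exists2 delta, 0 < delta <= 1 &
    [/\ gauge G, forall x, `|x| <= 1 -> G 2 x,
        forall x, G 1 x -> `|x| <= 1 &
        asymptotically_convex G t delta].
Proof.
move=> /andP[t0 t1] szX.
have [|G [tau /andP[tau0 tau1] [gG ballG Gball smoothG]]] :=
  @smooth_gauge R (dual X) (t / 8) _ szX; first by rewrite divr_gt0.
have polar_ball x : `|x| <= 1 -> polar G 2 x.
  move=> x1 g /Gball g2; apply: le_trans (ler_norm _) _.
  by apply: le_trans (dual_ball_le _ g2) _; rewrite ler_piMr.
exists (polar G), (tau * t / 4).
  by rewrite divr_gt0 ?mulr_gt0//=; nra.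
split=> //.
- split; last by exists 2.
  + by move=> a b x y Gx Gy g Gg; rewrite dual_appD lerD ?Gx ?Gy.
  + by move=> c a x c0 Gx g Gg; rewrite dual_appZ ler_wpM2l ?Gx.
- move=> x Gx; apply: norm_le_of_functionals => f f1.
  exact/Gx/ballG.
move=> z_ z Gz zz far g Gg.
(* The choice theta = t / 8 leaves the gain tau t / 4, with room for the errors
   of the three limits below. *)
have /choice[h_ hP] n : exists f : dual X, `|f| <= 1 /\ f (z_ n - z) = `|z_ n - z| :> R.
  by have [f f1 fz] := norming_functional (z_ n - z); exists f.
have [h hh h1] := dual_ball_wstar_compact (fun n => (hP n).1).
pose w_ n := 2^-1 *: (h_ n - h).
have w1 n : `|w_ n| <= 1.
  rewrite normrZ gtr0_norm ?invr_gt0// ler_pdivrMl// mulr1.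
  apply: le_trans (ler_normB _ _) _; have := (hP n).1; lra.
have w0 : weak_cvg w_ 0.
  apply: reflexive_weak_cvg_dual => x.
  have -> : (fun n => w_ n x : R) = (fun n => 2^-1 * (h_ n x - h x)) by [].
  have -> : ((0 : dual X) x : R) = 2^-1 * (h x - h x) by rewrite subrr mulr0.
  by apply: cvgMr; apply: cvgB; [exact: hh|exact: cvg_cst].
pose e := tau * t / 32.
have e0 : 0 < e by rewrite divr_gt0// mulr_gt0.
have gz : \forall n \near freeU, g z - e < g (z_ n).
  by apply: cvgr_gt (zz g) _ _; rewrite ltrBlDr ltrDl.
have hz : \forall n \near freeU, h (z_ n) < h z + t / 32.
  by apply: cvgr_lt (zz h) _ _; rewrite ltrDl divr_gt0.
have h_z : \forall n \near freeU, h z - t / 32 < h_ n z.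
  by apply: cvgr_gt (hh z) _ _; rewrite ltrBlDr ltrDl divr_gt0.
have [n [dn [gn [hn [hn' sn]]]]] := filter_ex (filterI far (filterI gz
  (filterI hz (filterI h_z (smoothG _ _ Gg w1 w0))))).
have := polar_scale gG _ sn (Gz n).
rewrite dualD_app dualZ_app dualZ_app dualB_app => /(_ _)/wrap[].
  by rewrite addr_gt0// !mulr_gt0// invr_gt0.
have := (hP n).2; rewrite dual_appB => hd le1.
have : tau * (t / 2 - t / 32) <= tau * (2^-1 * (h_ n (z_ n) - h (z_ n))).
  by rewrite ler_wpM2l ?ltW//; lra.
by have := mulr_gt0 tau0 t0; rewrite /e in gn; lra.
Qed.

End AsymptoticConvexity.

(** * Forks *)

Section Fork.
Context {R : realType} {X : normedModType R}.

(** In a fork with handle p and separated prongs y_n, of gauge at most 1, some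
    path from the end of the handle to the tip of a prong is shorter than 2 by a
    fixed ratio. *)
Definition fork_shrinking (G : R -> X -> Prop) (t kappa : R) :=
  forall (p : X) (y_ : nat -> X), G 1 p -> (forall n, G 1 (y_ n)) ->
  (forall n k, n <> k -> 2 * t <= `|y_ n - y_ k|) ->
  exists n, G (2 * kappa) (p + y_ n).

(** By the triangle inequality at most one y_n is closer than t to y. *)
Lemma separated_far_from_point (y_ : nat -> X) (y : X) (t : R) :
  (forall n k, n <> k -> 2 * t <= `|y_ n - y_ k|) ->
  \forall n \near freeU, t <= `|y_ n - y|.
Proof.
move=> sep; have [all_far|/existsNP[k /negP]] := pselect (forall n, t <= `|y_ n - y|).
  exact: filterE.
rewrite -ltNge => yk; apply: near_freeU; exists k.+1 => // n /= kn.
have nk : n <> k by move=> nk; rewrite nk ltnn in kn.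
have := sep n k nk; have := ler_distD y (y_ n) (y_ k).
by rewrite [`|y - _|]distrC; lra.
Qed.

(** The body is C + eta S with C asymptotically convex and S smooth.  The term
    eta S makes the sum smooth at the scale eta tau, at the cost of an enlargement
    of C that eats up half of the convexity gain delta when eta = delta / 8.  The
    fork is handled by writing p + y_n = (p + s y_n) + (1 - s) y_n with
    s = eta tau / 4: the weak limit p + s y of the first term has gauge at most
    1 + s (1 - delta / 2), and the smoothness parameter eta delta / 32 makes the
    error of replacing y by y_n at most half of the gain s delta / 2. *)
Lemma fork_gauge (t : R) : reflexive_space X -> 0 < t <= 1 ->
    (forall eps : R, 0 < eps -> exists n,
      iter n (szlenk_deriv eps) (@dual_unit_ball R X) = set0) ->
    (forall eps : R, 0 < eps -> exists n,
      iter n (szlenk_deriv eps) (@dual_unit_ball R (dual X)) = set0) ->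
  exists G, exists2 kappa, 0 < kappa < 1 &
    [/\ gauge G, forall x, `|x| <= 1 -> G 2 x,
        forall x, G 1 x -> `|x| <= 2 & fork_shrinking G t kappa].
Proof.
move=> reflX /andP[t0 t1] szX szdX.
have [|C [delta /andP[d0 d1] [gC ballC Cball convC]]] :=
  @convex_gauge R X reflX (t / 2) _ szdX.
  by rewrite divr_gt0//=; lra.
pose eta := delta / 8.
have eta0 : 0 < eta by rewrite divr_gt0.
have [|S [tau /andP[tau0 tau1] [gS ballS Sball smoothS]]] :=
  @smooth_gauge R X (eta * delta / 32) _ szX.
  by rewrite divr_gt0// mulr_gt0.
pose G a x := exists y w, [/\ x = y + w, C a y & S (eta * a) w].
have S0 a : 0 <= a -> S a 0.
  move=> a0; have := gaugeZ gS a0 (ballS 0 _).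
  by rewrite normr0 scaler0 mulr1; apply.
have CG a x : 0 <= a -> C a x -> G a x.
  by move=> a0 Cx; exists x, 0; rewrite addr0; split=> //; apply: S0; rewrite mulr_ge0// ltW.
have gG : gauge G.
  split.
  - move=> a b _ _ [y [w [-> Cy Sw]]] [y' [w' [-> Cy' Sw']]].
    exists (y + y'), (w + w'); split; first by rewrite addrACA.
      exact: (gaugeD gC).
    by rewrite mulrDr; exact: (gaugeD gS).
  - move=> c a _ c0 [y [w [-> Cy Sw]]].
    exists (c *: y), (c *: w); split; first by rewrite scalerDr.
      exact: (gaugeZ gC).
    by rewrite mulrCA; exact: (gaugeZ gS).
  - by exists 2 => // x x1; apply: CG => //; exact: ballC.
have S_norm w : S eta w -> `|w| <= 2 * eta.
  move=> Sw; have /(gaugeZ gS)/(_ Sw) : 0 <= eta^-1 by rewrite invr_ge0 ltW.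
  rewrite mulVf ?gt_eqF// => /Sball.
  by rewrite normrZ gtr0_norm ?invr_gt0// ler_pdivrMl// mulrC.
have Gball x : G 1 x -> `|x| <= 2.
  move=> [y [w [-> /Cball y1]]]; rewrite mulr1 => /S_norm w1.
  apply: le_trans (ler_normD _ _) _; apply: le_trans (lerD y1 w1) _.
  by rewrite /eta; lra.
have GC x : G 1 x -> C (1 + delta / 2) x.
  move=> [y [w [-> Cy]]]; rewrite mulr1 => /S_norm w1.
  apply: (gaugeD gC) => //; apply: gauge_le (gauge_norm _ gC ballC) => //.
  by rewrite /eta in w1; lra.
have convG (y_ : nat -> X) (y : X) : (forall n, G 1 (y_ n)) -> weak_cvg y_ y ->
    (\forall n \near freeU, t <= `|y_ n - y|) -> G (1 - delta / 2) y.
  move=> Gy yy far; pose a := 1 + delta / 2.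
  have a0 : 0 < a by rewrite /a; lra.
  have ai0 : 0 <= a^-1 by rewrite invr_ge0 ltW.
  have := convC (fun n => a^-1 *: y_ n) (a^-1 *: y).
  move=> /(_ _ _ _)/wrap[n||| Cy].
  - by have := gaugeZ gC ai0 (GC _ (Gy n)); rewrite mulVf// gt_eqF.
  - move=> f; rewrite dual_appZ.
    have -> : (fun n => f (a^-1 *: y_ n) : R) = (fun n => a^-1 * f (y_ n)).
      by apply/funext => n; exact: dual_appZ.
    by apply: cvgMr; exact: yy.
  - apply: filterS far => n yn; rewrite -scalerBr normrZ ger0_norm//.
    rewrite ler_pdivlMl//; apply: le_trans yn; rewrite /a; nra.
  apply: CG; first by lra.
  have := gaugeZ gC (ltW a0) Cy; rewrite scalerA mulfV ?gt_eqF// scale1r.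
  by apply: gauge_le => //; rewrite /a; nra.
have smoothG (q : X) (u_ : nat -> X) : G 1 q -> (forall n, `|u_ n| <= 1) ->
    weak_cvg u_ 0 -> \forall n \near freeU,
    G (1 + eta * delta / 32 * tau) (q + (eta * tau) *: u_ n).
  move=> [y [w [-> Cy Sw]]] u1 u0.
  have ei0 : 0 <= eta^-1 by rewrite invr_ge0 ltW.
  have Sw' : S 1 (eta^-1 *: w).
    by have := gaugeZ gS ei0 Sw; rewrite mulr1 mulVf// gt_eqF.
  apply: filterS (smoothS _ _ Sw' u1 u0) => n Sn.
  exists y, (w + (eta * tau) *: u_ n); split; first by rewrite addrA.
    apply: gauge_le Cy => //; rewrite lerDl.
    by rewrite !mulr_ge0// ltW.
  have := gaugeZ gS (ltW eta0) Sn.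
  by rewrite scalerDr !scalerA mulfV ?gt_eqF// scale1r.
pose s := eta * tau / 4.
have s0 : 0 < s by rewrite divr_gt0// mulr_gt0.
have s1 : s <= 1 / 4 by rewrite /s /eta; nra.
exists G, (1 - s * delta / 8).
  by apply/andP; split; nra.
split=> // [x x1|p y_ Gp Gy sep].
  by apply: CG => //; exact: ballC.
have [y yy] := reflexive_weak_compact reflX (fun n => Gball _ (Gy n)).
have y2 := weak_cvg_norm_le yy (fun n => Gball _ (Gy n)).
have Gyy := convG _ _ Gy yy (separated_far_from_point y sep).
pose rho := 1 + s * (1 - delta / 2).
have rho1 : 1 <= rho <= 2 by apply/andP; rewrite /rho; split; nra.
have [rho_ge1 rho_le2] := andP rho1.
have rho0 : 0 < rho by lra.
have Gq : G 1 (rho^-1 *: (p + s *: y)).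
  have ri0 : 0 <= rho^-1 by rewrite invr_ge0 ltW.
  have := gaugeZ gG ri0 (gaugeD gG Gp (gaugeZ gG (ltW s0) Gyy)).
  by rewrite mulVf// gt_eqF.
(* Since y_n - y has norm at most 4, the vectors u_n are in the unit ball, and
   rho eta tau u_n = s (y_n - y). *)
pose u_ n := (4 * rho)^-1 *: (y_ n - y).
have u1 n : `|u_ n| <= 1.
  rewrite normrZ gtr0_norm ?invr_gt0 ?mulr_gt0// ler_pdivrMl ?mulr_gt0//.
  apply: le_trans (ler_normB _ _) _; have := Gball _ (Gy n); lra.
have u0 : weak_cvg u_ 0.
  move=> f; have -> : (fun n => f (u_ n) : R) =
      (fun n => (4 * rho)^-1 * (f (y_ n) - f y)).
    by apply/funext => n; rewrite dual_appZ dual_appB.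
  have -> : f 0 = (4 * rho)^-1 * (f y - f y) :> R by rewrite subrr mulr0 linear0.
  by apply: cvgMr; apply: cvgB; [exact: yy|exact: cvg_cst].
have [n Gn] := filter_ex (smoothG _ _ Gq u1 u0); exists n.
have s1' : 0 <= 1 - s by lra.
have := gaugeD gG (gaugeZ gG (ltW rho0) Gn) (gaugeZ gG s1' (Gy n)).
have -> : rho *: (rho^-1 *: (p + s *: y) + (eta * tau) *: u_ n) +
    (1 - s) *: y_ n = p + y_ n.
  rewrite scalerDr !scalerA mulfV ?gt_eqF// scale1r.
  have -> : rho * (eta * tau) / (4 * rho) = s.
    by rewrite /s; field; rewrite gt_eqF.
  by rewrite scalerBr scalerBl scale1r -!addrA (addrCA (s *: y)) addNKr
    (addrC (s *: y_ n)) addrNK.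
apply: gauge_le => //.
have : rho * (eta * delta / 32 * tau) <= 2 * (eta * delta / 32 * tau).
  by rewrite ler_wpM2r// !mulr_ge0// ltW.
rewrite /rho /s; lra.
Qed.

End Fork.

(** * Paths in the countably branching tree *)

Section Paths.

(** Forks are indexed by nat, children in the tree by positive integers. *)
Definition posnat_of (n : nat) : posnat := exist _ n.+1 isT.

Lemma posnat_of_inj : injective posnat_of.
Proof. by move=> m n [] . Qed.

Lemma common_prefix_refl (T : eqType) (s : seq T) : common_prefix s s = s.
Proof. by elim: s => //= x s ->; rewrite eqxx. Qed.

Lemma common_prefix_rcons (T : eqType) (s : seq T) (x y : T) : x != y ->
  common_prefix (rcons s x) (rcons s y) = s.
Proof.
by move=> xy; elim: s => [|z s IHs] /=; [rewrite (negPf xy)|rewrite eqxx IHs].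
Qed.

Lemma common_prefix_rcons_l (T : eqType) (s : seq T) (x : T) :
  common_prefix (rcons s x) s = s.
Proof. by elim: s => //= y s ->; rewrite eqxx. Qed.

Context (b : seq posnat -> posnat -> posnat).

(** The embedding of the tree into its even levels which sends the child a of u to
    the grandchild of the image of u reached through a and then the selected
    child.  The accumulator s is the image of the path read so far; recursing from
    the root makes the behaviour on common prefixes immediate. *)
Fixpoint interleave (s u : seq posnat) : seq posnat :=
  if u is a :: u' then a :: b s a :: interleave (s ++ [:: a; b s a]) u' else [::].

Lemma size_interleave s u : size (interleave s u) = (2 * size u)%N.
Proof. by elim: u s => //= a u IHu s; rewrite IHu mulnS. Qed.

Lemma interleave_rcons s u a : interleave s (rcons u a) =
  rcons (rcons (interleave s u) a) (b (s ++ interleave s u) a).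
Proof.
elim: u s => [|c u IHu] s /=; first by rewrite cats0.
by rewrite IHu -catA.
Qed.

Lemma size_common_prefix_interleave s u v :
  size (common_prefix (interleave s u) (interleave s v)) =
  (2 * size (common_prefix u v))%N.
Proof.
elim: u v s => [|a u IHu] [|c v] s //=; case: eqVneq => //= <-.
by rewrite eqxx /= IHu mulnS.
Qed.

End Paths.

(** * Self-improvement of tree embeddings *)

Section SelfImprovement.
Context {R : realType} {X : normedModType R}.

Definition path_dist (s t : seq posnat) : R :=
  (size s)%:R + (size t)%:R - 2 * (size (common_prefix s t))%:R.

(** Only the edges are bounded above, through the gauge: the halving step
    shortens paths that descend the tree and says nothing about the others. *)
Definition tree_spread (G : R -> X -> Prop) (N : nat) (lambda : R)
    (f : seq posnat -> X) :=
  (forall s t, (size s <= N)%N -> (size t <= N)%N ->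
    path_dist s t <= `|f s - f t|) /\
  (forall s a, (size s < N)%N -> G lambda (f (rcons s a) - f s)).

(** For each vertex s and child a, the fork property applied to the edge from s
    to s a and to the edges leaving s a selects a grandchild beta s a; the map
    follows these grandchildren and is divided by 2.  The siblings s a b are at
    distance 2 from each other, and lambda t <= 1 turns this into the separation
    2 t required after normalising by lambda. *)
Lemma tree_spread_halve G t kappa N lambda f : gauge G ->
    fork_shrinking G t kappa -> 0 < lambda -> lambda * t <= 1 ->
    tree_spread G (2 * N) lambda f ->
  exists g, tree_spread G N (kappa * lambda) g.
Proof.
move=> gG fork l0 lt1 [ff Gf].
have l0' : lambda != 0 by rewrite gt_eqF.
have li0 : 0 <= lambda^-1 by rewrite invr_ge0 ltW.
have /choice[b bP] (sa : seq posnat * posnat) : exists b,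
    (size sa.1 + 2 <= 2 * N)%N ->
    G (2 * kappa * lambda) (f (rcons (rcons sa.1 sa.2) b) - f sa.1).
  case: sa => s a /=; have [sN|] := leqP (size s + 2) (2 * N); last first.
    by exists (posnat_of 0).
  pose y n := f (rcons (rcons s a) (posnat_of n)) - f (rcons s a).
  have Gp : G lambda (f (rcons s a) - f s) by apply: Gf; lia.
  have Gy n : G lambda (y n) by apply: Gf; rewrite size_rcons; lia.
  have Gn1 x : G lambda x -> G 1 (lambda^-1 *: x).
    by move=> /(gaugeZ gG li0); rewrite mulVf.
  have sep n m : n <> m -> 2 * t <= `|lambda^-1 *: y n - lambda^-1 *: y m|.
    move=> nm; rewrite -scalerBr normrZ ger0_norm// ler_pdivlMl// mulrCA.
    apply: (@le_trans _ _ 2); first by rewrite ler_piMr.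
    rewrite /y opprB addrA subrK.
    have := ff (rcons (rcons s a) (posnat_of n)) (rcons (rcons s a) (posnat_of m)).
    rewrite /path_dist common_prefix_rcons ?(inj_eq posnat_of_inj); last exact/eqP.
    rewrite !size_rcons => /(_ _ _)/wrap[||]; [lia|lia|].
    by rewrite -!natr1; lra.
  have [n Gn] := fork _ _ (Gn1 _ Gp) (fun n => Gn1 _ (Gy n)) sep.
  exists (posnat_of n) => _; have := gaugeZ gG (ltW l0) Gn.
  rewrite -scalerDr scalerA mulfV// scale1r mulrC /y.
  by rewrite [X in G _ X]addrC subrKA.
pose beta s a := b (s, a).
exists (fun u => 2^-1 *: f (interleave beta [::] u)); split=> [u v uN vN|u a uN].
  rewrite -scalerBr normrZ gtr0_norm ?invr_gt0// ler_pdivlMl//.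
  have := ff (interleave beta [::] u) (interleave beta [::] v).
  rewrite /path_dist !size_interleave size_common_prefix_interleave !natrM.
  by rewrite !leq_mul2l => /(_ uN vN); lra.
rewrite interleave_rcons -scalerBr /=.
have -> : kappa * lambda = 2^-1 * (2 * kappa * lambda) by lra.
apply: (gaugeZ gG); first by rewrite invr_ge0.
by apply: (bP (interleave beta [::] u, a)); rewrite size_interleave /=; lia.
Qed.

Lemma tree_spread_shrink G t kappa k lambda f : gauge G ->
    fork_shrinking G t kappa -> 0 < kappa <= 1 -> 0 < lambda ->
    0 <= t -> lambda * t <= 1 ->
    tree_spread G (2 ^ k) lambda f ->
  exists g, tree_spread G 1 (kappa ^+ k * lambda) g.
Proof.
move=> gG fork /andP[k0 k1] + t0.
elim: k lambda f => [|k IHk] lambda f l0 lt1 ff; first by exists f; rewrite mul1r.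
move: ff; rewrite expnS => /(tree_spread_halve _ fork l0 lt1)[//|g fg].
have [||h fh] := IHk (kappa * lambda) g _ _ fg; first exact: mulr_gt0.
  by apply: le_trans lt1; rewrite ler_wpM2r// ler_piMl// ltW.
by exists h; rewrite exprSr -mulrA.
Qed.

Lemma no_tree_spread G t kappa lambda : gauge G ->
    (forall x, G 1 x -> `|x| <= 2) ->
    fork_shrinking G t kappa -> 0 < kappa < 1 -> 0 < lambda ->
    0 <= t -> lambda * t <= 1 ->
  exists k, forall f, ~ tree_spread G (2 ^ k) lambda f.
Proof.
move=> gG Gball fork /andP[k0 k1] l0 t0 lt1.
have [k kl] : exists k, 2 * (kappa ^+ k * lambda) < 1.
  have : kappa ^+ n @[n --> \oo] --> (0 : R).
    by apply: cvg_expr; rewrite gtr0_norm.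
  move=> /cvgr_lt/(_ (2 * lambda)^-1); rewrite invr_gt0 mulr_gt0// => /(_ isT).
  move=> /filter_ex[k]; rewrite -[_^-1]mul1r ltr_pdivlMr ?mulr_gt0// => kk.
  by exists k; rewrite mulrCA.
exists k => f ff; have [|g [gg Gg]] := tree_spread_shrink gG fork _ l0 t0 lt1 ff.
  by rewrite k0 ltW.
have kl0 : 0 < kappa ^+ k * lambda by rewrite mulr_gt0// exprn_gt0.
have := Gg [::] (posnat_of 0) isT; have kli : 0 <= (kappa ^+ k * lambda)^-1.
  by rewrite invr_ge0 ltW.
move=> /(gaugeZ gG kli); rewrite mulVf ?gt_eqF// => /Gball.
rewrite normrZ ger0_norm// ler_pdivrMl//.
have := gg [:: posnat_of 0] [::] isT isT; rewrite /path_dist /=; lra.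
Qed.

End SelfImprovement.

(** * From bounded distortion to expanding maps *)

Section Embedding.
Context {R : realType} {X : normedModType R}.

(** Both suprema in the distortion are positive, so a finite product makes each
    of them finite. *)
Lemma embedding_lipschitz (C : R) (M M' : Type) (d : M -> M -> R)
    (d' : M' -> M' -> R) (f : M -> M') (p q : M) :
    (distortion d d' f <= C%:E)%E -> p <> q ->
    (forall x y, x <> y -> 0 < d x y) -> (forall x y, x <> y -> 0 < d' (f x) (f y)) ->
  exists A B : R, [/\ 0 < A, 0 < B, A * B <= C,
    forall x y, x <> y -> d' (f x) (f y) <= A * d x y &
    forall x y, x <> y -> d x y <= B * d' (f x) (f y)].
Proof.
rewrite /distortion => fC pq d0 d'0; move: fC.
set S1 := ereal_sup _; set S2 := ereal_sup _.
have S1ub x y : x <> y -> ((d' (f x) (f y) / d x y)%:E <= S1)%E.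
  by move=> xy; apply: ereal_sup_ubound; exists (x, y).
have S2ub x y : x <> y -> ((d x y / d' (f x) (f y))%:E <= S2)%E.
  by move=> xy; apply: ereal_sup_ubound; exists (x, y).
have S10 : (0 < S1)%E.
  by apply: lt_le_trans (S1ub _ _ pq); rewrite lte_fin divr_gt0 ?d0 ?d'0.
have S20 : (0 < S2)%E.
  by apply: lt_le_trans (S2ub _ _ pq); rewrite lte_fin divr_gt0 ?d0 ?d'0.
case: S1 S1ub S10 => [A| |] S1ub S10; case: S2 S2ub S20 => [B| |] S2ub S20 //.
- rewrite -EFinM !lte_fin lee_fin in S10 S20 * => ABC.
  exists A, B; split=> // x y xy.
    by have := S1ub x y xy; rewrite lee_fin ler_pdivrMr// d0.
  by have := S2ub x y xy; rewrite lee_fin ler_pdivrMr// d'0.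
- by rewrite gt0_muley.
- by rewrite gt0_mulye.
Qed.

Lemma path_dist_gt0 (s t : seq posnat) : s <> t -> 0 < @path_dist R s t.
Proof.
move=> st; rewrite /path_dist -natrM -natrD subr_gt0 ltr_nat.
elim: s t st => [|x s IHs] [|y t] //= st; case: eqVneq => [xy|_] /=; last by rewrite addSn.
by rewrite mulnS addSn addnS !ltnS (IHs t (fun e => st (congr2 cons xy e))).
Qed.

(** Rescaling by the Lipschitz constant of the inverse makes the embedding
    expanding, with edges of norm at most C, hence of gauge at most 2 C. *)
Lemma tree_spread_of_embeds (G : R -> X -> Prop) (C : R) (N : nat) :
    gauge G -> (forall x, `|x| <= 1 -> G 2 x) -> (0 < N)%N ->
    embeds C (@tree_dist R N) (@norm_dist R X) ->
  exists f, tree_spread G N (2 * C) f.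
Proof.
move=> gG ballG N0 [f f_inj fC].
pose path (s : seq posnat) : tree N := insub_bseq N s.
have pathK s : (size s <= N)%N -> path s = s :> seq posnat.
  by move=> sN; rewrite /path /insub_bseq val_insubd sN.
have [A [B [A0 B0 ABC fA fB]]] : exists A B : R, [/\ 0 < A, 0 < B, A * B <= C,
    forall x y, x <> y -> norm_dist (f x) (f y) <= A * tree_dist R x y &
    forall x y, x <> y -> tree_dist R x y <= B * norm_dist (f x) (f y)].
  apply: (embedding_lipschitz (p := path [::]) (q := path [:: posnat_of 0])) => //.
  - by move=> /(congr1 (fun u : tree N => val u)); rewrite /= !pathK.
  - by move=> x y xy; apply: path_dist_gt0 => /val_inj.
  - by move=> x y xy; rewrite normr_gt0 subr_eq0; apply/eqP => /f_inj.
exists (fun s => B *: f (path s)); split=> [s t sN tN|s a sN].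
  rewrite -scalerBr normrZ gtr0_norm//; have [->|/eqP st] := eqVneq s t.
    by rewrite /path_dist common_prefix_refl subrr normr0; lra.
  have := fB (path s) (path t); rewrite /tree_dist !pathK//; apply => e.
  by apply: st; rewrite -(pathK s)// -(pathK t)// e.
have := gauge_norm (B *: f (path (rcons s a)) - B *: f (path s)) gG ballG.
apply: gauge_le => //; rewrite mulrC ler_wpM2l// -scalerBr normrZ gtr0_norm//.
apply: le_trans ABC; rewrite mulrC ler_wpM2r ?(ltW B0)//.
have := fA (path (rcons s a)) (path s).
rewrite /tree_dist !pathK ?size_rcons// 1?ltnW//.
rewrite common_prefix_rcons_l -natr1 => /(_ _)/wrap[|].
  move=> /(congr1 (fun u : tree N => size u)); rewrite !pathK ?size_rcons// 1?ltnW//.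
  by lia.
by rewrite /norm_dist; lra.
Qed.

End Embedding.

(** * Conclusion *)

Theorem theorem3p1 (R : realType) (X : completeNormedModType R) :
  separable_space X -> reflexive_space X ->
  (exists C : R, 1 <= C /\
     forall N : nat, (0 < N)%N -> embeds C (@tree_dist R N) (@norm_dist R X)) ->
  eolt (Some omega) (Sz X) \/ eolt (Some omega) (Sz (dual X)).
Proof.
move=> _ reflX [C [C1 embC]]; apply: contrapT => /not_orP[szX szdX].
have C0 : 0 < 2 * C by lra.
have t01 : 0 < (2 * C)^-1 <= 1.
  by rewrite invr_gt0 C0 invf_le1//; lra.
have [G [kappa kappa01 [gG ballG Gball fork]]] :=
  fork_gauge reflX t01 (finite_szlenk_index szX) (finite_szlenk_index szdX).
have [||k no] := no_tree_spread gG Gball fork kappa01 C0.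
- by rewrite invr_ge0 ltW.
- by rewrite mulfV ?gt_eqF.
have k0 : (0 < 2 ^ k)%N by rewrite expn_gt0.
have [f ff] := tree_spread_of_embeds gG ballG k0 (embC _ k0).
exact: no ff.
Qed.
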